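(* Let $\mathbf{M}=(M_0,M_1,\ldots,M_k)$, $M_i\in\mathbb{R}^{n\times n}$, have the row $\mathcal{W}$-property and let $0\le\eta<1$. Let $\mathbf{A}=(A_0,A_1,\ldots,A_k)$ and $\mathbf{B}=(B_0,B_1,\ldots,B_k)$ both be in $\mathfrak{M}_\eta$, and let $\bar{\mathbf{q}}=(\bar q_0,\ldots,\bar q_k)$ and $\bar{\mathbf{p}}=(\bar p_0,\ldots,\bar p_k)$ with $\bar q_i,\bar p_i\in\mathbb{R}^n$. Then EVLCP $(\mathbf{A},\bar{\mathbf{q}})$ and EVLCP $(\mathbf{B},\bar{\mathbf{p}})$ have unique solutions $x^*$ and $y^*$, respectively. Moreover, $$\|x^*-y^*\|\le\Big(\sum_{i=0}^k\tau_i(\mathbf{M})\|A_i-B_i\|\Big)\Big(\sum_{i=0}^k\tau_i(\mathbf{M})\|\bar p_i\|\Big)+\sum_{i=0}^k\tau_i(\mathbf{M})\|\bar q_i-\bar p_i\|.$$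
   Context: EVLCP $(\mathbf{M},\mathbf{q})$, for $\mathbf{M}=(M_0,\ldots,M_k)$ with $M_i\in\mathbb{R}^{n\times n}$ and $\mathbf{q}=(q_0,\ldots,q_k)$ with $q_i\in\mathbb{R}^n$, is the problem of finding $x\in\mathbb{R}^n$ with $\min\{M_0x+q_0,M_1x+q_1,\ldots,M_kx+q_k\}=0$, where $\min$ is the componentwise minimum. $\mathbf{M}$ has the row $\mathcal{W}$-property if $\min(M_0x,\ldots,M_kx)\le 0\le \max(M_0x,\ldots,M_kx)$ (componentwise min, max and inequalities) implies $x=0$. $\mathcal{D}$ is the set of all tuples $(D_0,\ldots,D_k)$ of $n\times n$ diagonal matrices with diagonal entries in $[0,1]$ and $\sum_{i=0}^kD_i=I$. For $(D_0,\ldots,D_k)\in\mathcal{D}$ put $S_{\mathbf{M}}=\sum_{i=0}^kD_iM_i$ (nonsingular for every such tuple when $\mathbf{M}$ has the row $\mathcal{W}$-property), and $\alpha_i(\mathbf{M})=\max_{(D_0,\ldots,D_k)\in\mathcal{D}}\|S_{\mathbf{M}}^{-1}D_i\|$ for $i=0,\ldots,k$. $\mathfrak{M}_\eta=\{\mathbf{A}=(A_0,\ldots,A_k): A_i\in\mathbb{R}^{n\times n},\ \sum_{i=0}^k\alpha_i(\mathbf{M})\|A_i-M_i\|\le\eta<1\}$ and $\tau_i(\mathbf{M})=\frac{1}{1-\eta}\alpha_i(\mathbf{M})$. $\|\cdot\|$ denotes a fixed vector $p$-norm with $p\ge 1$ ($p=\infty$ allowed) and, for matrices, its induced operator norm.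 *)

(* Defs.v *)
From mathcomp Require Import all_boot all_order all_algebra.
From mathcomp Require Import boolp classical_sets reals constructive_ereal exp.

Set Implicit Arguments.
Unset Strict Implicit.
Unset Printing Implicit Defensive.

Import Order.TTheory GRing.Theory Num.Theory.

Local Open Scope classical_set_scope.
Local Open Scope ring_scope.

(* A tuple (M_0, ..., M_k) is a function on 'I_k.+1. *)

Section Norms.
Context {R : realType} {n : nat}.

(* Meaningful for 1 <= p <= +oo; the value at p = -oo is junk. *)
Definition pnorm (p : \bar R) (x : 'cV[R]_n) : R :=
  match p with
  | EFin r => (\sum_(j < n) `|x j 0| `^ r) `^ r^-1
  | +oo%E => \big[Num.max/0]_(j < n) `|x j 0|
  | -oo%E => 0
  end.

(* The unit ball, rather than the unit sphere, keeps the set nonempty when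
   n = 0. *)
Definition opnorm (p : \bar R) (A : 'M[R]_n) : R :=
  sup [set pnorm p (A *m x) | x in [set x | pnorm p x <= 1]].

End Norms.

Section EVLCP.
Context {R : realType} {n k : nat}.

Definition vmin (v : 'I_k.+1 -> 'cV[R]_n) : 'cV[R]_n :=
  \col_j \big[Num.min/v ord0 j 0]_(i < k.+1) v i j 0.

Definition vmax (v : 'I_k.+1 -> 'cV[R]_n) : 'cV[R]_n :=
  \col_j \big[Num.max/v ord0 j 0]_(i < k.+1) v i j 0.

Definition EVLCP_sol (M : 'I_k.+1 -> 'M[R]_n) (q : 'I_k.+1 -> 'cV[R]_n)
    (x : 'cV[R]_n) : Prop :=
  vmin (fun i => M i *m x + q i) = 0.

Definition row_W (M : 'I_k.+1 -> 'M[R]_n) : Prop :=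
  forall x : 'cV[R]_n,
    (forall j, vmin (fun i => M i *m x) j 0 <= 0) ->
    (forall j, 0 <= vmax (fun i => M i *m x) j 0) ->
    x = 0.

Definition diag_tuples : set ('I_k.+1 -> 'M[R]_n) :=
  [set D | (forall i, is_diag_mx (D i) /\ forall j, 0 <= D i j j <= 1) /\
           \sum_(i < k.+1) D i = 1%:M].

Definition S_mx (M D : 'I_k.+1 -> 'M[R]_n) : 'M[R]_n :=
  \sum_(i < k.+1) D i *m M i.

(* When M has the row W-property, every S_mx M D is invertible and the sup is
   a maximum, by compactness of diag_tuples. *)
Definition alpha (p : \bar R) (M : 'I_k.+1 -> 'M[R]_n) (i : 'I_k.+1) : R :=
  sup [set opnorm p (invmx (S_mx M D) *m D i) | D in diag_tuples].

Definition M_eta (p : \bar R) (M : 'I_k.+1 -> 'M[R]_n) (eta : R) :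
    set ('I_k.+1 -> 'M[R]_n) :=
  [set A | \sum_(i < k.+1) alpha p M i * opnorm p (A i - M i) <= eta < 1].

Definition tau (p : \bar R) (M : 'I_k.+1 -> 'M[R]_n) (eta : R)
    (i : 'I_k.+1) : R :=
  (1 - eta)^-1 * alpha p M i.

End EVLCP.

(* Main.v *)
Require Import Defs.
From mathcomp Require Import all_boot all_order all_algebra.
From mathcomp Require Import boolp classical_sets reals constructive_ereal exp.
From mathcomp Require Import ring lra.
From mathcomp Require interval_inference convex hoelder.

Set Implicit Arguments.
Unset Strict Implicit.
Unset Printing Implicit Defensive.

Import Order.TTheory GRing.Theory Num.Theory.

Local Open Scope classical_set_scope.
Local Open Scope ring_scope.

(** The theorem reduces to one estimate. Two vectors with componentwise minimum
    0 have a difference whose entries, in each row, take both signs (weakly) as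
    the piece index varies; so in each row some convex combination of them
    vanishes. Hence if x solves EVLCP (A, q) and y solves EVLCP (B, r), there is
    a diagonal tuple D with
      S_A(D) (x - y) = sum_i D_i ((B_i - A_i) y + (r_i - q_i)).
    Replacing S_A(D) by S_M(D) + sum_i D_i (A_i - M_i), multiplying by the
    inverse of S_M(D) and absorbing the term of factor at most eta gives
    [perturbation_bound]: if S_A(D) z = sum_i D_i u_i, then the norm of z is at
    most sum_i tau_i |u_i|. With u = 0 it says that every S_A(D) is
    nonsingular, so that A inherits the row W-property; comparing y with the
    solution 0 of EVLCP (B, 0) it bounds the norm of y by sum_i tau_i |r_i|.

    Two further facts are needed about a tuple with the row W-property.

    Its EVLCP is uniquely solvable. Uniqueness is immediate from the sign
    remark. Existence ([EVLCP_exists]) goes one row at a time, starting from the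
    linear system that uses one chosen piece per row. Suppose that a row m may
    be prescribed to be any single piece i, with solution x_i. The x_i satisfy
    the same equations in all other rows, so by the row W-property ([row_W_line]) the m-th
    entries of M_l (x_i - x_i') have the same sign for all l: the x_i are
    linearly ordered, and the largest one satisfies the min equation in row m.

    The suprema alpha_i are over bounded sets, so that they are upper bounds.
    The same order argument shows that the solution of S_M(D) x = w is a convex
    combination of two solutions for which one row of D has been moved to a
    vertex of the simplex ([S_mx_step]). So the norm of x is at most the
    largest norm for the finitely many tuples D all of whose rows are vertices
    ([S_mx_vertices]). *)

(** * The p-norm and its operator norm *)

Section PNorm.
Context {R : realType} {n : nat}.
Implicit Types (p : \bar R) (x y : 'cV[R]_n) (A : 'M[R]_n).

Lemma powR_conv (r t a b : R) : 1 <= r -> 0 <= t <= 1 -> 0 <= a -> 0 <= b ->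
  (t * a + (1 - t) * b) `^ r <= t * a `^ r + (1 - t) * b `^ r.
Proof.
move=> r1 /andP[t0 t1] a0 b0.
have := hoelder.convex_powR r1 (interval_inference.Itv01 t0 t1) (x := a) (y := b).
by rewrite !inE /= !in_itv /= !andbT => /(_ a0 b0).
Qed.

Lemma exponent_ind (P : \bar R -> Prop) :
  (forall r : R, 1 <= r -> P r%:E) -> P +oo%E -> forall p, (1 <= p)%E -> P p.
Proof.
move=> Pr Poo [r| |].
- by rewrite lee_fin; apply: Pr.
- by move=> _.
- by [].
Qed.

Lemma pnorm_ge0 p x : 0 <= pnorm p x.
Proof.
case: p => [r| |] //=; first exact: powR_ge0.
by apply: (big_ind (fun t => 0 <= t)) => // a b a0 b0; rewrite le_max a0.
Qed.

Lemma pnorm_powR (r : R) x : 0 < r ->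
  pnorm r%:E x `^ r = \sum_(j < n) `|x j 0| `^ r.
Proof.
move=> r0; rewrite /= -powRrM mulVf ?gt_eqF// powRr1//.
by apply: sumr_ge0 => j _; apply: powR_ge0.
Qed.

Lemma le_pnorm p x y : (1 <= p)%E ->
  (forall j, `|x j 0| <= `|y j 0|) -> pnorm p x <= pnorm p y.
Proof.
move=> hp hxy; move: p hp; apply: exponent_ind => [r hr|] /=.
  have r0 : 0 <= r by lra.
  apply: ge0_ler_powR; rewrite ?invr_ge0 ?nnegrE//.
  - by apply: sumr_ge0 => j _; apply: powR_ge0.
  - by apply: sumr_ge0 => j _; apply: powR_ge0.
  - by apply: ler_sum => j _; apply: ge0_ler_powR; rewrite ?nnegrE.
by apply: le_bigmax2 => j _.
Qed.

Lemma coord_le_pnorm p x j : (1 <= p)%E -> `|x j 0| <= pnorm p x.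
Proof.
move: p; apply: exponent_ind => [r hr|] /=; last first.
  exact: (@le_bigmax _ _ _ _ (fun j => `|x j 0|)).
have r0 : 0 < r by lra.
rewrite -[leLHS]powRr1// -[X in _ `^ X](@divff _ r) ?gt_eqF// powRrM.
apply: ge0_ler_powR; rewrite ?invr_ge0 ?nnegrE ?powR_ge0 ?(ltW r0)//.
  by apply: sumr_ge0 => i _; apply: powR_ge0.
by rewrite (bigD1 j)//= lerDl; apply: sumr_ge0 => i _; apply: powR_ge0.
Qed.

Lemma pnormZ p (c : R) x : (1 <= p)%E -> pnorm p (c *: x) = `|c| * pnorm p x.
Proof.
move: p; apply: exponent_ind => [r hr|] /=.
  have r0 : 0 < r by lra.
  under eq_bigr do rewrite mxE normrM powRM//.
  rewrite -mulr_sumr powRM ?powR_ge0//; last first.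
    by apply: sumr_ge0 => i _; apply: powR_ge0.
  by rewrite -powRrM mulfV ?gt_eqF// powRr1.
apply: (big_ind2 (fun a b => a = `|c| * b)); rewrite ?mulr0//.
  by move=> a b a' b' -> ->; rewrite maxr_pMr.
by move=> j _; rewrite mxE normrM.
Qed.

Lemma pnorm_eq0 p x : (1 <= p)%E -> pnorm p x <= 0 -> x = 0.
Proof.
move=> hp x0; apply/matrixP => j l; rewrite ord1 mxE; apply/eqP; rewrite -normr_le0.
by rewrite (le_trans (coord_le_pnorm x j hp) x0).
Qed.

Lemma pnorm0 p : (1 <= p)%E -> pnorm p (0 : 'cV[R]_n) = 0.
Proof. by move=> hp; rewrite -(scale0r 0) pnormZ// normr0 mul0r. Qed.

Lemma pnormN p x : (1 <= p)%E -> pnorm p (- x) = pnorm p x.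
Proof. by move=> hp; rewrite -scaleN1r pnormZ// normrN1 mul1r. Qed.

(** Minkowski's inequality, from the convexity of the power function: u_j + v_j
    is (a + b) times the convex combination of u_j / a and v_j / b with weights
    a / (a + b) and b / (a + b), and both scaled families have r-th powers
    summing to 1. *)
Lemma minkowski_sum (r a b : R) (u v : 'I_n -> R) : 1 <= r -> 0 < a -> 0 < b ->
  (forall j, 0 <= u j) -> (forall j, 0 <= v j) ->
  \sum_j u j `^ r = a `^ r -> \sum_j v j `^ r = b `^ r ->
  \sum_j (u j + v j) `^ r <= (a + b) `^ r.
Proof.
move=> r1 a0 b0 u0 v0 ua vb; have r0 : 0 < r by apply: lt_le_trans r1.
have ab0 : 0 < a + b by rewrite addr_gt0.
pose t := a / (a + b).
have t1 : 1 - t = b / (a + b) by rewrite /t; field; rewrite gt_eqF.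
have t0 : 0 <= t by rewrite divr_ge0// ltW.
have t1' : 0 <= 1 - t by rewrite t1 divr_ge0// ltW.
have scal (w : 'I_n -> R) c : 0 < c -> (forall j, 0 <= w j) ->
    \sum_j w j `^ r = c `^ r -> \sum_j (w j / c) `^ r = 1.
  move=> c0 w0 wc; under eq_bigr do rewrite powRM ?invr_ge0 ?(ltW c0)//.
  rewrite -mulr_suml wc -powRM ?invr_ge0 ?(ltW c0)//.
  by rewrite divff ?gt_eqF// powR1.
have -> : (a + b) `^ r = \sum_j
    (a + b) `^ r * (t * (u j / a) `^ r + (1 - t) * (v j / b) `^ r).
  rewrite -mulr_sumr big_split -!mulr_sumr /= !scal//.
  by rewrite !mulr1 addrC subrK mulr1.
apply: ler_sum => j _.
have ua0 : 0 <= u j / a by rewrite divr_ge0// ltW.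
have vb0 : 0 <= v j / b by rewrite divr_ge0// ltW.
apply: le_trans (ler_wpM2l (powR_ge0 _ _) (powR_conv r1 _ ua0 vb0)); last first.
  by rewrite t0 -subr_ge0.
rewrite -powRM ?(ltW ab0)//; last by rewrite addr_ge0// mulr_ge0.
rewrite t1 /t le_eqVlt; apply/orP; left; apply/eqP; congr (_ `^ r).
by field; rewrite !gt_eqF.
Qed.

Lemma ler_pnormD p x y : (1 <= p)%E -> pnorm p (x + y) <= pnorm p x + pnorm p y.
Proof.
move=> hp.
have [x0|x0] := leP (pnorm p x) 0.
  by rewrite (pnorm_eq0 hp x0) add0r pnorm0// add0r.
have [y0|y0] := leP (pnorm p y) 0.
  by rewrite (pnorm_eq0 hp y0) addr0 pnorm0// addr0.
move: p hp x0 y0; apply: exponent_ind => [r r1|] a0 b0; last first.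
  apply/bigmax_leP; split=> [|j _].
    by rewrite addr_ge0// ltW.
  rewrite mxE (le_trans (ler_normD _ _))//.
  by apply: lerD; apply: (@coord_le_pnorm +oo%E); rewrite leey.
have r0 : 0 < r by apply: lt_le_trans r1.
have powK c : 0 <= c -> c = (c `^ r) `^ r^-1.
  by move=> c0; rewrite -powRrM divff ?gt_eqF// powRr1.
have ab0 := addr_ge0 (ltW a0) (ltW b0); rewrite [leRHS](powK _ ab0).
apply: ge0_ler_powR; rewrite ?invr_ge0 ?nnegrE ?powR_ge0 ?(ltW r0)//.
  by apply: sumr_ge0 => i _; apply: powR_ge0.
apply: le_trans (minkowski_sum r1 a0 b0 _ _ (esym (pnorm_powR x r0))
  (esym (pnorm_powR y r0))) => //.
apply: ler_sum => j _; apply: ge0_ler_powR; rewrite ?nnegrE ?addr_ge0// ?(ltW r0)//.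
by rewrite mxE ler_normD.
Qed.

Lemma ler_pnorm_sum p (I : finType) (v : I -> 'cV[R]_n) : (1 <= p)%E ->
  pnorm p (\sum_i v i) <= \sum_i pnorm p (v i).
Proof.
move=> hp; apply: (big_ind2 (fun x a => pnorm p x <= a)) => //.
  by rewrite pnorm0.
by move=> x a y b xa yb; rewrite (le_trans (ler_pnormD _ _ hp))// lerD.
Qed.

Lemma opnorm_set0 p A : (1 <= p)%E ->
  [set pnorm p (A *m x) | x in [set x | pnorm p x <= 1]] 0.
Proof. by move=> hp; exists 0; rewrite /= ?mulmx0 pnorm0. Qed.

(** The supremum defining the operator norm is an honest one: A x is the
    combination of the columns of A by coordinates of modulus at most 1. *)
Lemma opnorm_ub p A : (1 <= p)%E ->
  has_ubound [set pnorm p (A *m x) | x in [set x | pnorm p x <= 1]].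
Proof.
move=> hp; exists (\sum_j pnorm p (col j A)) => _ [x /= x1 <-].
have -> : A *m x = \sum_j x j 0 *: col j A.
  apply/colP => i; rewrite !mxE summxE; apply: eq_bigr => j _.
  by rewrite !mxE mulrC.
apply: le_trans (ler_pnorm_sum _ hp) _; apply: ler_sum => j _.
rewrite pnormZ// ler_piMl ?pnorm_ge0//.
exact: le_trans (coord_le_pnorm x j hp) x1.
Qed.

Lemma opnorm_ge0 p A : (1 <= p)%E -> 0 <= opnorm p A.
Proof. by move=> hp; apply: ub_le_sup; [exact: opnorm_ub|exact: opnorm_set0]. Qed.

Lemma pnorm_mulmx p A x : (1 <= p)%E ->
  pnorm p (A *m x) <= opnorm p A * pnorm p x.
Proof.
move=> hp; have [x0|x0] := leP (pnorm p x) 0.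
  by rewrite (pnorm_eq0 hp x0) mulmx0 pnorm0// mulr0.
rewrite -ler_pdivrMr// mulrC -[_^-1]ger0_norm ?invr_ge0 ?(ltW x0)//.
rewrite -pnormZ// scalemxAr; apply: ub_le_sup; first exact: opnorm_ub.
exists ((pnorm p x)^-1 *: x) => //=.
by rewrite pnormZ// ger0_norm ?invr_ge0 ?(ltW x0)// mulVf ?gt_eqF.
Qed.

Lemma opnorm_le p A (c : R) : (1 <= p)%E -> 0 <= c ->
  (forall x, pnorm p (A *m x) <= c * pnorm p x) -> opnorm p A <= c.
Proof.
move=> hp c0 Ac; apply: ge_sup; first by exists 0; exact: opnorm_set0.
by move=> _ [x /= x1 <-]; rewrite (le_trans (Ac x))// ler_piMr.
Qed.

End PNorm.

(** * Families of reals that change sign *)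

Section Straddle.
Context {R : realType} {k : nat}.
Implicit Types a b d : 'I_k.+1 -> R.

(** Equivalent to min a <= 0 <= max a, stated by its two witnesses, which are what the
    arguments below produce and consume. *)
Definition straddles a := (exists i, a i <= 0) /\ (exists i, 0 <= a i).

Definition weights d := (forall i, 0 <= d i) /\ \sum_i d i = 1.

Definition vertex (i : 'I_k.+1) : 'I_k.+1 -> R := fun l => (l == i)%:R.

Lemma vertex_weights i : weights (vertex i).
Proof.
split=> [l|]; first exact: ler0n.
by rewrite (bigD1 i)//= /vertex eqxx big1 ?addr0// => l /negPf ->.
Qed.

Lemma vertex_sum i a : \sum_l vertex i l * a l = a i.
Proof.
rewrite (bigD1 i)//= /vertex eqxx mul1r big1 ?addr0// => l /negPf ->.
by rewrite mul0r.
Qed.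

Lemma weights_sum_gt0 d a : weights d -> (forall i, 0 < a i) ->
  0 < \sum_i d i * a i.
Proof.
move=> [d0 d1] a0.
have da0 i : 0 <= d i * a i by rewrite mulr_ge0// ltW.
rewrite lt0r sumr_ge0// andbT; apply/negP => /eqP s0.
have : \sum_i d i = 0.
  apply: big1 => i _.
  have /eqP := psumr_eq0P (fun i _ => da0 i) s0 (erefl : xpredT i).
  by rewrite mulf_eq0 (gt_eqF (a0 i)) orbF => /eqP.
by rewrite d1 => /eqP; rewrite oner_eq0.
Qed.

Lemma weights_sum_straddles d a : weights d -> \sum_i d i * a i = 0 ->
  straddles a.
Proof.
move=> dw s0; split.
  apply: contrapT => /forallNP h.
  have : 0 < \sum_i d i * a i.
    by apply: weights_sum_gt0 => // i; rewrite ltNge; apply/negP/h.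
  by rewrite s0 ltxx.
apply: contrapT => /forallNP h.
have : 0 < \sum_i d i * - a i.
  by apply: weights_sum_gt0 => // i; rewrite oppr_gt0 ltNge; apply/negP/h.
by under eq_bigr do rewrite mulrN; rewrite sumrN s0 oppr0 ltxx.
Qed.

Lemma convex_root (a b : R) : a <= 0 -> 0 <= b ->
  exists2 t, 0 <= t <= 1 & t * a + (1 - t) * b = 0.
Proof.
move=> a0 b0; have [ab|ab] := eqVneq (b - a) 0.
  have [-> ->] : a = 0 /\ b = 0 by split; lra.
  by exists 0; [rewrite lexx ler01 | rewrite !mulr0 addr0].
have ba : 0 < b - a by rewrite lt0r ab subr_ge0 (le_trans a0 b0).
exists (b / (b - a)); last by field.
by rewrite divr_ge0 ?(ltW ba)//= ler_pdivrMr// mul1r lerDl oppr_ge0.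
Qed.

Lemma straddles_weights a : straddles a ->
  exists2 d, weights d & \sum_i d i * a i = 0.
Proof.
case=> -[i ai] [l al]; have [t /andP[t0 t1] ht] := convex_root ai al.
have t1' : 0 <= 1 - t by rewrite subr_ge0.
exists (fun m => t * vertex i m + (1 - t) * vertex l m).
  split=> [m|]; first by rewrite addr_ge0// mulr_ge0// ler0n.
  rewrite big_split/= -!mulr_sumr (vertex_weights i).2 (vertex_weights l).2.
  by rewrite !mulr1 addrC subrK.
under eq_bigr do rewrite mulrDl -!mulrA.
by rewrite big_split/= -!mulr_sumr !vertex_sum.
Qed.

Definition min_zero a := (forall i, 0 <= a i) /\ exists i, a i = 0.

Lemma min_zero_straddles a b : min_zero a -> min_zero b ->
  straddles (fun i => a i - b i).
Proof.
move=> [a0 [i ai]] [b0 [l bl]]; split.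
  by exists i; rewrite ai sub0r oppr_le0.
by exists l; rewrite bl subr0.
Qed.

End Straddle.

(** * The row W-property and unique solvability *)

Section RowW.
Context {R : realType} {n k : nat}.
Implicit Types (M : 'I_k.+1 -> 'M[R]_n) (d : 'I_n -> 'I_k.+1 -> R).
Implicit Types (q v : 'I_k.+1 -> 'cV[R]_n) (x w z : 'cV[R]_n) (m : 'I_n).

Lemma addcE x z j : (x + z) j 0 = x j 0 + z j 0.
Proof. by rewrite mxE. Qed.

Lemma mulmxBE (A : 'M[R]_n) x z j :
  (A *m (x - z)) j 0 = (A *m x) j 0 - (A *m z) j 0.
Proof. by rewrite mulmxBr addcE; congr (_ + _); rewrite mxE. Qed.

Lemma vmin_le v j i : vmin v j 0 <= v i j 0.
Proof. by rewrite mxE; apply: bigmin_le. Qed.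

Lemma vmin_eq v j : exists i, vmin v j 0 = v i j 0.
Proof.
rewrite mxE; apply: (big_ind (fun t => exists i, t = v i j 0)).
- by exists ord0.
- by move=> a b ? ?; rewrite /Num.min; case: ifP.
- by move=> i _; exists i.
Qed.

Lemma vmax_ge v j i : v i j 0 <= vmax v j 0.
Proof. by rewrite mxE; exact: (le_bigmax _ (fun i => v i j 0) i). Qed.

Lemma vmax_eq v j : exists i, vmax v j 0 = v i j 0.
Proof.
rewrite mxE; apply: (big_ind (fun t => exists i, t = v i j 0)).
- by exists ord0.
- by move=> a b ? ?; rewrite /Num.max; case: ifP.
- by move=> i _; exists i.
Qed.

Lemma row_WP M : row_W M <->
  forall x, (forall j, straddles (fun i => (M i *m x) j 0)) -> x = 0.
Proof.
split=> h x.
  move=> st; apply: h => j; have [[i hi] [l hl]] := st j.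
    exact: le_trans (vmin_le _ j i) hi.
  exact: le_trans hl (vmax_ge _ j l).
move=> h1 h2; apply: h => j; split.
  by have [i e] := vmin_eq (fun i => M i *m x) j; exists i; rewrite -e.
by have [i e] := vmax_eq (fun i => M i *m x) j; exists i; rewrite -e.
Qed.

Lemma EVLCP_solP M q x : EVLCP_sol M q x <->
  forall j, min_zero (fun i => (M i *m x + q i) j 0).
Proof.
rewrite /EVLCP_sol; split=> [h j|h].
  have v0 : vmin (fun i => M i *m x + q i) j 0 = 0 by rewrite h mxE.
  split=> [i|]; first by rewrite -v0 vmin_le.
  by have [i e] := vmin_eq (fun i => M i *m x + q i) j; exists i; rewrite -e.
apply/colP => j; rewrite [RHS]mxE; have [h0 [i hi]] := h j.
apply/eqP; rewrite eq_le; apply/andP; split.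
  by rewrite -[leRHS]hi; apply: (@vmin_le (fun i => M i *m x + q i)).
by have [l ->] := vmin_eq (fun i => M i *m x + q i) j.
Qed.

Definition diag_of d : 'I_k.+1 -> 'M[R]_n :=
  fun i => diag_mx (\row_j d j i).

Lemma diag_of_mulE d i x j : (diag_of d i *m x) j 0 = d j i * x j 0.
Proof. by rewrite mul_diag_mx !mxE. Qed.

Lemma diag_tuplesP (D : 'I_k.+1 -> 'M[R]_n) : diag_tuples D <->
  exists2 d, (forall j, weights (d j)) & D = diag_of d.
Proof.
split=> [[h s]|[d dw ->]].
  exists (fun j i => D i j j).
    move=> j; split=> [i|]; first by have [_ /(_ j) /andP[]] := h i.
    by have := congr1 (fun A : 'M_n => A j j) s; rewrite summxE mxE eqxx.
  apply/funext => i; apply/matrixP => j l; rewrite !mxE.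
  have [->|jl] := eqVneq j l; first by rewrite mulr1n.
  rewrite mulr0n; apply: (is_diag_mxP (h i).1).
  by apply: contra_neq jl => e; exact/val_inj.
split=> [i|].
  split; first exact: diag_mx_is_diag.
  move=> j; rewrite !mxE eqxx mulr1n (dw j).1/=.
  by rewrite -(dw j).2 (bigD1 i)//= lerDl sumr_ge0// => l _; exact: (dw j).1.
apply/matrixP => j l; rewrite summxE !mxE.
under eq_bigr do rewrite !mxE.
have [->|_] := eqVneq j l; last by apply: big1.
by under eq_bigr do rewrite mulr1n; rewrite (dw l).2.
Qed.

Lemma S_mxE M d x j :
  (S_mx M (diag_of d) *m x) j 0 = \sum_i d j i * (M i *m x) j 0.
Proof.
rewrite /S_mx mulmx_suml summxE; apply: eq_bigr => i _.
by rewrite -mulmxA diag_of_mulE.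
Qed.

Lemma unitmx_inj (A : 'M[R]_n) :
  (forall x : 'cV[R]_n, A *m x = 0 -> x = 0) -> A \in unitmx.
Proof.
move=> h; rewrite -unitmx_tr -row_free_unit; apply: inj_row_free => v vA.
by rewrite -[v]trmxK (h v^T) ?trmx0// -[A]trmxK -trmx_mul vA trmx0.
Qed.

(** A vector satisfies the sign conditions of the row W-property if and only if
    some S_mx M D with D a diagonal tuple annihilates it, because 0 lies between
    the minimum and the maximum of finitely many reals exactly when it is a
    convex combination of them. *)
Lemma row_W_S_mx M : row_W M <->
  forall d, (forall j, weights (d j)) -> S_mx M (diag_of d) \in unitmx.
Proof.
split=> [/row_WP hM d dw|h].
  apply: unitmx_inj => x Sx; apply: hM => j.
  by apply: weights_sum_straddles (dw j) _; rewrite -S_mxE Sx mxE.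
apply/row_WP => x st.
have [d hd] := choice (fun j => match straddles_weights (st j) with
  ex_intro2 d dw e => ex_intro _ d (conj dw e) end).
have Su := h d (fun j => (hd j).1).
rewrite -[x]mul1mx -(mulVmx Su) -mulmxA; apply/eqP.
have -> : S_mx M (diag_of d) *m x = 0; last by rewrite mulmx0.
by apply/colP => j; rewrite S_mxE mxE (hd j).2.
Qed.

(** When the sign condition is imposed in all rows but m, row m cannot also
    change sign unless z = 0. So the vectors z that solve the other rows are
    ordered by the sign of row m, which is the same for every piece; this plays
    the part of the monotonicity of a scalar equation along a line. *)
Lemma row_W_line M z m : row_W M ->
  (forall j, j != m -> straddles (fun i => (M i *m z) j 0)) ->
  forall i l, 0 <= (M i *m z) m 0 -> 0 <= (M l *m z) m 0.
Proof.
move=> /row_WP hM st i l zi; rewrite leNgt; apply/negP => zl.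
have z0 : z = 0.
  apply: hM => j; have [->|/st//] := eqVneq j m.
  by split; [exists l; exact: ltW | exists i].
by move: zl; rewrite z0 mulmx0 mxE ltxx.
Qed.

Definition set_row m (t : 'I_k.+1 -> R) d : 'I_n -> 'I_k.+1 -> R :=
  fun j => if j == m then t else d j.

(** The rows below c carry the min equation and the others the equation of the
    piece chosen by s; c increases one row at a time. *)
Lemma EVLCP_exists M q : row_W M -> exists x, EVLCP_sol M q x.
Proof.
move=> hM.
suff H (c : nat) : (c <= n)%N -> forall s : 'I_n -> 'I_k.+1, exists x,
    forall j : 'I_n, if (j < c)%N then min_zero (fun i => (M i *m x + q i) j 0)
                     else (M (s j) *m x + q (s j)) j 0 = 0.
  have [x hx] := H n (leqnn n) (fun=> ord0); exists x.
  by apply/EVLCP_solP => j; have := hx j; rewrite ltn_ord.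
elim: c => [_ s|c IH cn s].
  pose d j : 'I_k.+1 -> R := vertex (s j).
  have Su : S_mx M (diag_of d) \in unitmx.
    by apply: (row_W_S_mx M).1 => // j; apply: vertex_weights.
  pose w : 'cV[R]_n := \col_j - q (s j) j 0.
  exists (invmx (S_mx M (diag_of d)) *m w) => j /=.
  set x := _ *m w; have : S_mx M (diag_of d) *m x = w by rewrite mulKVmx.
  move=> /(congr1 (fun u : 'cV_n => u j 0)); rewrite S_mxE vertex_sum.
  by rewrite [in RHS]mxE => e; rewrite mxE e addNr.
pose m := Ordinal cn.
have [x hx] := choice (fun i => IH (ltnW cn) (fun j => if j == m then i else s j)).
have xm i : (M i *m x i + q i) m 0 = 0 by have := hx i m; rewrite ltnn eqxx.
(* The value of piece 0 in row m measures the order of the candidates x i;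
   by row_W_line any other piece would give the same order. *)
have [i0 _ i0max] := @arg_maxP _ _ _ (ord0 : 'I_k.+1) xpredT
  (fun i => (M ord0 *m x i) m 0) isT.
have line i j : j != m -> straddles (fun l => (M l *m (x i0 - x i)) j 0).
  move=> jm; have := hx i j; have := hx i0 j; rewrite (negPf jm).
  have -> : (fun l => (M l *m (x i0 - x i)) j 0) =
    (fun l => (M l *m x i0 + q l) j 0 - (M l *m x i + q l) j 0).
    by apply/funext => l; rewrite mulmxBE !addcE opprD addrACA subrr addr0.
  case: ifP => _ h1 h2; first exact: min_zero_straddles.
  by split; exists (s j); rewrite h1 h2 subr0.
exists (x i0) => j; rewrite ltnS leq_eqVlt.
have [jm|jm] := eqVneq (j : nat) c => /=; last first.
  have /negPf jm' : j != m by apply: contra_neq jm => ->.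
  by have := hx i0 j; rewrite jm'.
have -> : j = m by exact/val_inj.
split=> [i|]; last by exists i0.
have := @row_W_line M (x i0 - x i) m hM (line i) ord0 i.
rewrite !mulmxBE !subr_ge0 => /(_ (i0max i isT)) le_i.
by rewrite -(xm i) !addcE lerD2r.
Qed.

Lemma EVLCP_exists_unique M q : row_W M -> exists! x, EVLCP_sol M q x.
Proof.
move=> hM; have [x hx] := EVLCP_exists q hM; exists x; split=> // y /EVLCP_solP hy.
apply/eqP; rewrite -subr_eq0; apply/eqP; apply: (row_WP M).1 hM _ _ => j.
have := min_zero_straddles ((EVLCP_solP M q x).1 hx j) (hy j).
by under eq_fun do rewrite !addcE opprD addrACA subrr addr0 -mulmxBE.
Qed.

End RowW.

(** * Bounds uniform over the diagonal tuples *)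

Section Bound.
Context {R : realType} {n k : nat}.
Implicit Types (M : 'I_k.+1 -> 'M[R]_n) (d : 'I_n -> 'I_k.+1 -> R).
Implicit Types (x w z : 'cV[R]_n) (m : 'I_n).

Definition vertices (s : 'I_n -> 'I_k.+1) : 'I_n -> 'I_k.+1 -> R :=
  fun j => vertex (s j).

(** With row m moved to the vertex i, let y_i be the solution. The y_i and the
    solution x satisfy the same equations in the other rows, so they are
    linearly ordered by [row_W_line]. The equation of x in row m is a weighted
    average of those of the y_i, so x lies between two of them and its norm
    is at most the larger of theirs. *)
Lemma S_mx_step M p (hp : (1 <= p)%E) d m w : row_W M ->
  (forall j, weights (d j)) -> exists i,
  pnorm p (invmx (S_mx M (diag_of d)) *m w) <=
  pnorm p (invmx (S_mx M (diag_of (set_row m (vertex i) d))) *m w).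
Proof.
move=> hM dw; set x := invmx _ *m w.
have Sx : S_mx M (diag_of d) *m x = w by rewrite mulKVmx//; exact: (row_W_S_mx M).1.
clearbody x.
pose y i := invmx (S_mx M (diag_of (set_row m (vertex i) d))) *m w.
have dw' i j : weights (set_row m (vertex i) d j).
  by rewrite /set_row; case: ifP => // _; apply: vertex_weights.
have Sy i : S_mx M (diag_of (set_row m (vertex i) d)) *m y i = w.
  by rewrite mulKVmx//; exact: (row_W_S_mx M).1.
suff : exists i, pnorm p x <= pnorm p (y i) by [].
clearbody y.
have ym i : (M i *m y i) m 0 = w m 0.
  by rewrite -(Sy i) S_mxE /set_row eqxx vertex_sum.
have yj i j : j != m -> \sum_l d j l * (M l *m y i) j 0 = w j 0.
  by move=> /negPf jm; rewrite -[in RHS](Sy i) S_mxE /set_row jm.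
have xj j : \sum_l d j l * (M l *m x) j 0 = w j 0 by rewrite -S_mxE Sx.
have line (z : 'cV_n) : (forall j, j != m -> \sum_l d j l * (M l *m z) j 0 = 0) ->
  forall j, j != m -> straddles (fun l => (M l *m z) j 0).
  by move=> hz j jm; apply: weights_sum_straddles (dw j) (hz j jm).
have yx i j : j != m -> \sum_l d j l * (M l *m (y i - x)) j 0 = 0.
  move=> jm; under eq_bigr do rewrite mulmxBE mulrBr.
  by rewrite sumrB yj// xj subrr.
have avg : \sum_l d m l * ((M l *m x) m 0 - w m 0) = 0.
  under eq_bigr do rewrite mulrBr.
  by rewrite sumrB xj -mulr_suml (dw m).2 mul1r subrr.
(* The weighted average of the residuals of x in row m is 0: some piece has
   residual <= 0, so that y i1 is above x, and some has residual >= 0. *)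
have [[i1 h1] [i2 h2]] := weights_sum_straddles (dw m) avg.
pose a i := (M ord0 *m (y i - x)) m 0.
have a1 : 0 <= a i1.
  apply: (row_W_line hM (line _ (yx i1))) (i1) _ _.
  by rewrite mulmxBE ym subr_ge0 -subr_le0.
have a2 : a i2 <= 0.
  have xy j : j != m -> \sum_l d j l * (M l *m (x - y i2)) j 0 = 0.
    move=> jm; under eq_bigr do rewrite mulmxBE mulrBr.
    by rewrite sumrB xj yj// subrr.
  rewrite -oppr_ge0 /a mulmxBE opprB -mulmxBE.
  apply: (row_W_line hM (line _ xy)) (i2) _ _.
  by rewrite mulmxBE ym.
have [t /andP[t0 t1] ht] := convex_root a2 a1.
have t1' : 0 <= 1 - t by rewrite subr_ge0.
have xE : x = t *: y i2 + (1 - t) *: y i1.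
  apply/esym/eqP; rewrite -subr_eq0; apply/eqP.
  have -> : t *: y i2 + (1 - t) *: y i1 - x =
            t *: (y i2 - x) + (1 - t) *: (y i1 - x).
    rewrite !scalerBr addrACA -opprD -scalerDl [t + _]addrC subrK.
    by rewrite scale1r.
  set z := _ + _.
  have zE l j : (M l *m z) j 0 =
      t * (M l *m (y i2 - x)) j 0 + (1 - t) * (M l *m (y i1 - x)) j 0.
    by rewrite /z mulmxDr -!scalemxAr addcE; congr (_ + _); rewrite mxE.
  apply: (row_WP M).1 hM _ _ => j.
  have [->|jm] := eqVneq j m; first by split; exists ord0; rewrite zE ht.
  apply: line jm => {}j jm; under eq_bigr do rewrite zE mulrDr !(mulrCA (d _ _)).
  by rewrite big_split/= -!mulr_sumr !yx// !mulr0 addr0.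
have bound : pnorm p x <= t * pnorm p (y i2) + (1 - t) * pnorm p (y i1).
  rewrite {1}xE; apply: le_trans (ler_pnormD _ _ hp) _.
  by rewrite !pnormZ// !ger0_norm.
have le_max c : pnorm p (y i1) <= c -> pnorm p (y i2) <= c -> pnorm p x <= c.
  move=> c1 c2; apply: le_trans bound _.
  have -> : c = t * c + (1 - t) * c by ring.
  by rewrite lerD// ler_wpM2l.
by have [le12|/ltW le21] := leP (pnorm p (y i1)) (pnorm p (y i2));
  [exists i2|exists i1]; apply: le_max.
Qed.

Lemma S_mx_vertices M p (hp : (1 <= p)%E) d w : row_W M ->
  (forall j, weights (d j)) -> exists s : {ffun 'I_n -> 'I_k.+1},
  pnorm p (invmx (S_mx M (diag_of d)) *m w) <=
  pnorm p (invmx (S_mx M (diag_of (vertices s))) *m w).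
Proof.
move=> hM dw.
suff H (c : nat) : (c <= n)%N -> exists e : 'I_n -> 'I_k.+1 -> R,
    [/\ forall j, weights (e j),
        forall j : 'I_n, (j < c)%N -> exists i, e j = vertex i &
        pnorm p (invmx (S_mx M (diag_of d)) *m w) <=
        pnorm p (invmx (S_mx M (diag_of e)) *m w)].
  have [e [ew ev le]] := H n (leqnn n).
  have [s hs] := choice (fun j => ev j (ltn_ord j)).
  exists (finfun s); suff -> : vertices (finfun s) = e by [].
  by apply/funext => j; rewrite /vertices ffunE hs.
elim: c => [_|c IH cn]; first by exists d; split.
have [e [ew ev le]] := IH (ltnW cn); pose m := Ordinal cn.
have [i hi] := S_mx_step hp m w hM ew.
exists (set_row m (vertex i) e); split; last exact: le_trans le hi.
  by move=> j; rewrite /set_row; case: ifP => // _; apply: vertex_weights.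
move=> j; rewrite ltnS leq_eqVlt /set_row.
case: (eqVneq j m) => [_ _|jm]; first by exists i.
by case/predU1P => [jc|/ev//]; case/eqP: jm; exact/val_inj.
Qed.

(** The operator norms of the inverses at the finitely many vertex tuples give a
    common bound, and D_i does not increase the norm of a vector. *)
Lemma alpha_bounded M p i : (1 <= p)%E -> row_W M ->
  has_ubound [set opnorm p (invmx (S_mx M D) *m D i) | D in diag_tuples].
Proof.
move=> hp hM.
pose N (s : {ffun 'I_n -> 'I_k.+1}) :=
  opnorm p (invmx (S_mx M (diag_of (vertices s)))).
have N0 s : 0 <= N s by apply: opnorm_ge0.
exists (\sum_s N s) => _ [_ /diag_tuplesP[d dw ->] <-].
apply: opnorm_le => // [|x]; first exact: sumr_ge0.
rewrite -mulmxA; have [s hs] := S_mx_vertices hp (diag_of d i *m x) hM dw.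
apply: le_trans hs _; apply: le_trans (pnorm_mulmx _ _ hp) _.
apply: ler_pM; rewrite ?pnorm_ge0//; first exact: N0.
  by rewrite (bigD1 s)//= lerDl; apply: sumr_ge0.
apply: le_pnorm => // j; rewrite diag_of_mulE normrM ler_piMl//.
rewrite ger0_norm ?(dw j).1// -(dw j).2 (bigD1 i)//= lerDl.
by apply: sumr_ge0 => l _; exact: (dw j).1.
Qed.

Lemma opnorm_le_alpha M p d i : (1 <= p)%E -> row_W M ->
  (forall j, weights (d j)) ->
  opnorm p (invmx (S_mx M (diag_of d)) *m diag_of d i) <= alpha p M i.
Proof.
move=> hp hM dw; apply: ub_le_sup; first exact: alpha_bounded.
by exists (diag_of d) => //; apply/diag_tuplesP; exists d.
Qed.

Lemma alpha_ge0 M p i : (1 <= p)%E -> row_W M -> 0 <= alpha p M i.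
Proof.
move=> hp hM.
apply: le_trans (opnorm_le_alpha (d := fun=> vertex ord0) i hp hM _).
  exact: opnorm_ge0.
by move=> j; apply: vertex_weights.
Qed.

(** * Perturbation of the tuple *)

(** The estimate behind everything: S_A differs from S_M by sum_i D_i (A_i - M_i),
    whose effect after multiplication by the inverse of S_M is at most eta times
    the norm of z, and solving for that norm produces the factor 1 / (1 - eta)
    in tau. *)
Lemma perturbation_bound M (A : 'I_k.+1 -> 'M[R]_n) p eta d
    (u : 'I_k.+1 -> 'cV[R]_n) z :
  (1 <= p)%E -> row_W M -> M_eta p M eta A -> (forall j, weights (d j)) ->
  S_mx A (diag_of d) *m z = \sum_i diag_of d i *m u i ->
  pnorm p z <= \sum_i tau p M eta i * pnorm p (u i).
Proof.
move=> hp hM /andP[hA eta1] dw Sz.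
have Su : S_mx M (diag_of d) \in unitmx by apply: (row_W_S_mx M).1.
have zE : z = \sum_i invmx (S_mx M (diag_of d)) *m diag_of d i *m
                (u i - (A i - M i) *m z).
  under eq_bigr do rewrite -mulmxA.
  rewrite -mulmx_sumr; apply: (canRL (mulKmx Su)).
  under eq_bigr do rewrite mulmxBr mulmxA mulmxBr mulmxBl.
  by rewrite sumrB -Sz sumrB -!mulmx_suml subKr.
have bound : pnorm p z <=
    \sum_i alpha p M i * pnorm p (u i) + eta * pnorm p z.
  rewrite [in leLHS]zE; apply: le_trans (ler_pnorm_sum _ hp) _.
  apply: le_trans (_ : \sum_i (alpha p M i * pnorm p (u i) +
     alpha p M i * opnorm p (A i - M i) * pnorm p z) <= _); last first.
    rewrite big_split/= lerD2l -mulr_suml.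
    by apply: ler_wpM2r => //; exact: pnorm_ge0.
  apply: ler_sum => i _; rewrite -mulrA -mulrDr.
  apply: le_trans (pnorm_mulmx _ _ hp) _.
  apply: ler_pM; rewrite ?opnorm_ge0 ?pnorm_ge0 ?opnorm_le_alpha//.
  apply: le_trans (ler_pnormD _ _ hp) _; rewrite pnormN// lerD2l.
  exact: pnorm_mulmx.
under eq_bigr do rewrite /tau -mulrA.
rewrite -mulr_sumr mulrC ler_pdivlMr ?subr_gt0//.
by rewrite mulrBr mulr1 lerBlDr [_ * eta]mulrC.
Qed.

Lemma row_W_M_eta M (A : 'I_k.+1 -> 'M[R]_n) p eta :
  (1 <= p)%E -> row_W M -> M_eta p M eta A -> row_W A.
Proof.
move=> hp hM hA; apply/row_W_S_mx => d dw; apply: unitmx_inj => z Sz.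
apply: (pnorm_eq0 hp).
have := perturbation_bound (u := fun=> 0) (z := z) hp hM hA dw.
rewrite Sz big1 => [/(_ erefl)|i _]; last by rewrite mulmx0.
by rewrite big1// => i _; rewrite pnorm0// mulr0.
Qed.

(** In each row the differences of the two min-zero families change sign, which
    supplies weights d that turn the two nonlinear systems into a linear one
    for x - y. *)
Lemma solution_bound M (A B : 'I_k.+1 -> 'M[R]_n) p eta
    (q r : 'I_k.+1 -> 'cV[R]_n) x y :
  (1 <= p)%E -> row_W M -> M_eta p M eta A ->
  EVLCP_sol A q x -> EVLCP_sol B r y ->
  pnorm p (x - y) <=
  \sum_i tau p M eta i * pnorm p ((B i - A i) *m y + (r i - q i)).
Proof.
move=> hp hM hA /EVLCP_solP hx /EVLCP_solP hy.
have [d hd] := choice (fun j =>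
  match straddles_weights (min_zero_straddles (hx j) (hy j)) with
  ex_intro2 d dw e => ex_intro _ d (conj dw e) end).
apply: (perturbation_bound hp hM hA (d := d)) => [j|]; first exact: (hd j).1.
apply/colP => j; rewrite S_mxE summxE; apply/eqP.
rewrite -subr_eq0 -sumrB -[X in _ == X](hd j).2; apply/eqP/eq_bigr => i _.
rewrite diag_of_mulE -mulrBr; congr (_ * _).
rewrite mulmxBr mulmxBl; move: (A i *m x) (A i *m y) (B i *m y) => a b c.
by rewrite !mxE; ring.
Qed.

End Bound.

Theorem theorem3p2 (R : realType) (n k : nat) (p : \bar R) (hp : (1 <= p)%E)
    (M : 'I_k.+1 -> 'M[R]_n) (hM : row_W M)
    (eta : R) (heta : 0 <= eta < 1)
    (A B : 'I_k.+1 -> 'M[R]_n)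
    (hA : M_eta p M eta A) (hB : M_eta p M eta B)
    (qbar pbar : 'I_k.+1 -> 'cV[R]_n) :
  (exists! x, EVLCP_sol A qbar x) /\
  (exists! y, EVLCP_sol B pbar y) /\
  (forall x y : 'cV[R]_n, EVLCP_sol A qbar x -> EVLCP_sol B pbar y ->
     pnorm p (x - y) <=
       (\sum_(i < k.+1) tau p M eta i * opnorm p (A i - B i)) *
       (\sum_(i < k.+1) tau p M eta i * pnorm p (pbar i)) +
       \sum_(i < k.+1) tau p M eta i * pnorm p (qbar i - pbar i)).
Proof.
have tau0 i : 0 <= tau p M eta i.
  by case/andP: heta => _ /ltW h; rewrite mulr_ge0 ?alpha_ge0// invr_ge0 subr_ge0.
split; first exact: EVLCP_exists_unique (row_W_M_eta hp hM hA).
split; first exact: EVLCP_exists_unique (row_W_M_eta hp hM hB).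
move=> x y hx hy.
(* 0 solves EVLCP (B, 0), so solution_bound bounds y itself. *)
have y_le : pnorm p y <= \sum_i tau p M eta i * pnorm p (pbar i).
  have sol0 : EVLCP_sol B (fun=> 0) 0.
    apply/EVLCP_solP => j; have e i : (B i *m 0 + 0) j 0 = 0.
      by rewrite mulmx0 addr0 mxE.
    by split=> [i|]; [rewrite e | exists ord0; rewrite e].
  have := solution_bound hp hM hB hy sol0.
  by under eq_bigr do rewrite mulmx0 !add0r pnormN//; rewrite subr0.
apply: le_trans (solution_bound hp hM hA hx hy) _.
apply: le_trans (_ : \sum_i (tau p M eta i * opnorm p (A i - B i) * pnorm p y +
    tau p M eta i * pnorm p (qbar i - pbar i)) <= _).
  apply: ler_sum => i _; rewrite -mulrA -mulrDr; apply: ler_wpM2l => //.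
  rewrite -[_ *m y + _]opprK pnormN// opprD -mulNmx !opprB.
  by apply: le_trans (ler_pnormD _ _ hp) _; rewrite lerD2r pnorm_mulmx.
rewrite big_split/= -mulr_suml lerD2r; apply: ler_wpM2l => //.
by apply: sumr_ge0 => i _; rewrite mulr_ge0// opnorm_ge0.
Qed.
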